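(* Let $c\in\big(0,\tfrac{\pi}{\sqrt2}\big)$ and, for $n\ge3$, put $L_n=c\sqrt{\frac{n}{\log n}}$ and $x_n=-e^{-L_n}$. Then \[ \lim_{n\to\infty}\left(\frac{x\,A_n(x)\,\big((\log|x|)^2+\pi^2\big)^{(n+1)/2}}{n!\,(x-1)^{n+1}}-\widehat{J}_n(x)\right)=0 \] uniformly for $x\in\left[\frac1{x_n},\,x_n\right]$; that is, the supremum over $x\in\left[\frac1{x_n},x_n\right]$ of the absolute value of the expression in parentheses tends to $0$ as $n\to\infty$.
   Context: The Eulerian polynomials $(A_n(x))_{n\ge0}$ are defined by the exponential generating function \[ \sum_{n=0}^{\infty} A_n(x)\,\frac{t^n}{n!}=\frac{1-x}{e^{t(x-1)}-x},\qquad x\neq1 \] (so $A_0=A_1=1$, $A_2(x)=1+x$, $A_3(x)=1+4x+x^2$). For $x\in(-\infty,0)$, \[ \widehat{J}_n(x)=\frac{\big(\log|x|+\pi i\big)^{n+1}+\big(\log|x|-\pi i\big)^{n+1}}{\big((\log|x|)^2+\pi^2\big)^{(n+1)/2}}. \] *)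

(* Defs.v *)
From HB Require Import structures.
From mathcomp Require Import all_boot all_order all_algebra.
From mathcomp Require Import complex.
From mathcomp Require Import all_classical all_reals all_analysis.

Set Implicit Arguments.
Unset Strict Implicit.
Unset Printing Implicit Defensive.

Import Order.TTheory GRing.Theory Num.Theory.
Import numFieldNormedType.Exports.

Local Open Scope classical_set_scope.
Local Open Scope ring_scope.

(* For every real x <> 1 the generating series has a positive radius of
   convergence in t that depends on x (the singularities nearest to 0 are zeros
   of expR (t * (x - 1)) - x), so the identity is required for t near 0; it
   determines every polynomial A n. *)
Definition is_eulerian (R : realType) (A : nat -> {poly R}) : Prop :=
  forall x : R, x != 1 ->
    \forall t \near (0 : R),
      series (fun n : nat => (A n).[x] * (t ^+ n / n`!%:R)) @ \oo
        --> (1 - x) / (expR (t * (x - 1)) - x).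

(* Real-valued, being a sum of two conjugates, but kept in R[i]. *)
Definition Jhat (R : realType) (n : nat) (x : R) : R[i] :=
  ((ln `|x| +i* pi) ^+ n.+1 + (ln `|x| -i* pi) ^+ n.+1)%C /
  ((((ln `|x|) ^+ 2 + pi ^+ 2) `^ (n.+1%:R / 2))%:C)%C.

Definition scaled_eulerian (R : realType) (A : nat -> {poly R}) (n : nat)
    (x : R) : R :=
  x * (A n).[x] * (((ln `|x|) ^+ 2 + pi ^+ 2) `^ (n.+1%:R / 2)) /
  (n`!%:R * (x - 1) ^+ n.+1).

(* The values at n < 3, where ln n is 0 or below 1, are irrelevant to
   limits in n. *)
Definition Lseq (R : realType) (c : R) (n : nat) : R :=
  c * Num.sqrt (n%:R / ln n%:R).

Definition xseq (R : realType) (c : R) (n : nat) : R := - expR (- Lseq c n).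

(* Main.v *)
Require Import Defs.
From HB Require Import structures.
From mathcomp Require Import all_boot all_order all_algebra.
From mathcomp Require Import complex.
From mathcomp Require Import all_classical all_reals all_analysis.
From mathcomp Require Import ring lra zify.

Set Implicit Arguments.
Unset Strict Implicit.
Unset Printing Implicit Defensive.

Import Order.TTheory GRing.Theory Num.Theory.
Import numFieldNormedType.Exports.

Local Open Scope classical_set_scope.
Local Open Scope ring_scope.

(* Write [x = - e^l].  The bracketed expression is governed by the expansion
   [x A_n(x) / (n! (x - 1)^(n+1)) = \sum_k (l + (2k+1) pi i)^-(n+1)] over the
   poles of [1 / (e^s - x)]: the two poles nearest to 0 give [Jhat], and the
   others contribute at most [2 / |l + 3 pi i|^(n-1)].

   To avoid contour integration, [e^s] is replaced by [(1 + s/N)^N].  Then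
   [1 / ((1 + s/N)^N - x)] has [N] explicit simple poles, its partial fraction
   expansion is finite algebra, and its Taylor coefficients satisfy a recurrence
   which for [N -> oo] tends to the one satisfied by the Eulerian polynomials.
   The two nearest poles converge to [l +- pi i], and the tail bound is uniform
   in [N].

   For [|l| <= L_n] the remainder, scaled by [|l + pi i|^(n+1)], is at most
   [2 (L_n^2 + pi^2) exp (- 4 pi^2 (n-1) / (L_n^2 + 9 pi^2))], which is [O(1/n)]
   because [c^2 < pi^2 / 2]. *)

(** * Finite partial fractions *)

Section FinitePartialFractions.

(** Writing out one factor [w k - 1] lowers [j] and leads down to power sums of exponents [p] to
    [p + j]. These vanish below [N], and at exponent [N] each root contributes [x]. *)
Lemma sum_expr_subr1 (F : fieldType) (N : nat) (w : nat -> F) (x : F) :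
  (forall k, w k ^+ N = x) ->
  (forall p, (0 < p < N)%N -> \sum_(k < N) w k ^+ p = 0) ->
  forall j p, (0 < p)%N -> (p + j <= N)%N ->
  \sum_(k < N) w k ^+ p * (w k - 1) ^+ j
    = if (p + j == N)%N then N%:R * x else 0.
Proof.
move=> wN sum0; elim=> [|j IHj] p p0 pjN.
  rewrite addn0 in pjN *; under eq_bigr do rewrite expr0 mulr1.
  case: eqP => [->|/eqP pN]; last by rewrite sum0// p0 ltn_neqAle pN.
  by under eq_bigr do rewrite wN; rewrite sumr_const card_ord mulr_natl.
have -> : \sum_(k < N) w k ^+ p * (w k - 1) ^+ j.+1 =
    \sum_(k < N) w k ^+ p.+1 * (w k - 1) ^+ j -
    \sum_(k < N) w k ^+ p * (w k - 1) ^+ j.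
  rewrite -sumrB; apply: eq_bigr => k _.
  by rewrite exprS exprS; ring.
rewrite IHj ?IHj ?addSnnS//; last by rewrite addnS in pjN; exact: ltnW.
have /negbTE-> : (p + j != N)%N by rewrite neq_ltn -addnS pjN.
by rewrite subr0.
Qed.

(* Coefficient recurrence for the partial fraction expansion of
   [1 / ((1 + s) ^ N - x)], whose poles are the [w k - 1]. *)
Lemma partial_fraction_recurrence (F : fieldType) (N : nat) (w : nat -> F)
    (x : F) (n : nat) :
  (n < N)%N ->
  (forall k, w k ^+ N = x) -> (forall k, (k < N)%N -> w k != 1) ->
  (forall p, (0 < p < N)%N -> \sum_(k < N) w k ^+ p = 0) ->
  \sum_(j < n.+1) 'C(N, n - j)%:R * (\sum_(k < N) w k / (w k - 1) ^+ j.+1)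
    - x * (\sum_(k < N) w k / (w k - 1) ^+ n.+1)
  = - (if n == 0 then N%:R * x else 0).
Proof.
move=> nN wN w1 sum0.
(* Expanding [x = (1 + (w k - 1)) ^+ N] cancels every negative power of [w k - 1]; only the binomial
   terms with [m > n] remain. *)
have pole (k : 'I_N) : \sum_(j < n.+1) 'C(N, n - j)%:R *
      (w k / (w k - 1) ^+ j.+1) - x * (w k / (w k - 1) ^+ n.+1) =
    - \sum_(n.+1 <= m < N.+1) 'C(N, m)%:R * (w k * (w k - 1) ^+ (m - n.+1)).
  have r0 : w k - 1 != 0 by rewrite subr_eq0 w1.
  have xE : x = \sum_(0 <= m < N.+1) 'C(N, m)%:R * (w k - 1) ^+ m.
    rewrite -(wN k) -{1}(subrK 1 (w k)) addrC exprDn big_mkord.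
    by apply: eq_bigr => i _; rewrite expr1n mul1r mulr_natl.
  rewrite xE (@big_cat_nat _ _ _ n.+1)/=; [|by []|exact: ltnW].
  rewrite mulrDl opprD addrA.
  rewrite [X in X - _](_ : _ = 0) ?sub0r; last first.
    apply/eqP; rewrite subr_eq0; apply/eqP.
    rewrite big_mkord mulr_suml (reindex_inj rev_ord_inj)/=.
    apply: eq_bigr => i _; rewrite subSS subKn ?leq_ord//.
    rewrite -mulrA; congr (_ * _); rewrite mulrCA; congr (_ * _).
    rewrite -subSn ?leq_ord// exprB ?unitfE//; last exact: leqW (leq_ord i).
    by field; rewrite !expf_neq0.
  congr (- _); rewrite mulr_suml !big_nat; apply: eq_bigr => m /andP[nm _].
  rewrite -mulrA; congr (_ * _); rewrite mulrCA; congr (_ * _).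
  by rewrite exprB ?unitfE.
under eq_bigr do rewrite mulr_sumr.
rewrite exchange_big/= mulr_sumr -sumrB; under eq_bigr do rewrite pole.
rewrite sumrN exchange_big/=; congr (- _).
(* Summed over the roots, term [m] has top exponent [m - n], which reaches [N] only for [m = N] and
   [n = 0]. *)
rewrite big_nat_recr//= big_nat big1 ?add0r; last first.
  move=> m /andP[nm mN]; rewrite -mulr_sumr.
  under eq_bigr do rewrite -[X in X * _]expr1.
  rewrite (sum_expr_subr1 wN sum0)//; last by lia.
  by rewrite ifF ?mulr0//; apply/negbTE; lia.
rewrite binn -mulr_sumr mul1r; under eq_bigr do rewrite -[X in X * _]expr1.
rewrite (sum_expr_subr1 wN sum0)//; last by lia.
by congr (if _ then _ else _); lia.
Qed.

End FinitePartialFractions.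

(** * Complex sequences and the complex exponential *)

Section ComplexSequences.
Variable R : realType.
Implicit Types (u v : nat -> R[i]) (y z : R[i]).
Local Notation Re := complex.Re.
Local Notation Im := complex.Im.
Local Notation normc := ComplexField.Normc.normc.

(** Componentwise, so that limit theorems over [R] apply directly. *)
Definition ccvg u z :=
  ((fun n => Re (u n)) @ \oo --> Re z) /\ ((fun n => Im (u n)) @ \oo --> Im z).

Lemma eq_ccvg u v z : u =1 v -> ccvg u z -> ccvg v z.
Proof. by move=> /funext->. Qed.

Lemma ccvg_cst z : ccvg (fun=> z) z.
Proof. by split; exact: cvg_cst. Qed.

Lemma ccvg_real (a : nat -> R) (r : R) :
  a @ \oo --> r -> ccvg (fun n => (a n)%:C%C) r%:C%C.
Proof. by move=> ar; split => //=; exact: cvg_cst. Qed.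

Lemma ReM y z : Re (y * z) = Re y * Re z - Im y * Im z.
Proof. by case: y z => [a b] [c d]. Qed.

Lemma ImM y z : Im (y * z) = Re y * Im z + Im y * Re z.
Proof. by case: y z => [a b] [c d]. Qed.

Lemma ccvgD u v y z :
  ccvg u y -> ccvg v z -> ccvg (fun n => u n + v n) (y + z).
Proof.
move=> [ur ui] [vr vi]; split.
  by rewrite raddfD; under eq_fun do rewrite raddfD; exact: cvgD.
by rewrite raddfD; under eq_fun do rewrite raddfD; exact: cvgD.
Qed.

Lemma ccvgN u y : ccvg u y -> ccvg (fun n => - u n) (- y).
Proof.
move=> [ur ui]; split.
  by rewrite raddfN; under eq_fun do rewrite raddfN; exact: cvgN.
by rewrite raddfN; under eq_fun do rewrite raddfN; exact: cvgN.
Qed.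

Lemma ccvgM u v y z :
  ccvg u y -> ccvg v z -> ccvg (fun n => u n * v n) (y * z).
Proof.
move=> [ur ui] [vr vi]; split.
  by rewrite ReM; under eq_fun do rewrite ReM; apply: cvgB; exact: cvgM.
by rewrite ImM; under eq_fun do rewrite ImM; apply: cvgD; exact: cvgM.
Qed.

Lemma ccvgX u y (k : nat) : ccvg u y -> ccvg (fun n => u n ^+ k) (y ^+ k).
Proof.
move=> uy; elim: k => [|k IHk]; first exact: ccvg_cst.
by rewrite exprS; under [X in ccvg X]funext do rewrite exprS; exact: ccvgM.
Qed.

Lemma ccvg_sum (k : nat) (u : 'I_k -> nat -> R[i]) (z : 'I_k -> R[i]) :
  (forall i, ccvg (u i) (z i)) ->
  ccvg (fun n => \sum_(i < k) u i n) (\sum_(i < k) z i).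
Proof.
elim: k u z => [|k IHk] u z uz.
  by rewrite big_ord0; under [X in ccvg X]funext do rewrite big_ord0;
    exact: ccvg_cst.
rewrite big_ord_recl; under [X in ccvg X]funext do rewrite big_ord_recl.
by apply: ccvgD; [exact: uz|apply: IHk => i; exact: uz].
Qed.

Lemma sqr_normc z : normc z ^+ 2 = Re z ^+ 2 + Im z ^+ 2.
Proof. by case: z => a b /=; rewrite sqr_sqrtr// addr_ge0 ?sqr_ge0. Qed.

Lemma normc_ge0 z : 0 <= normc z.
Proof. by case: z => a b /=; exact: sqrtr_ge0. Qed.

Lemma normc_real (r : R) : normc r%:C%C = `|r|.
Proof. by rewrite /= expr0n addr0 sqrtr_sqr. Qed.

Lemma normcX z (n : nat) : normc (z ^+ n) = normc z ^+ n.
Proof.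
elim: n => [|n IHn]; first by rewrite !expr0 ComplexField.Normc.normc1.
by rewrite !exprS ComplexField.Normc.normcM IHn.
Qed.

Lemma normc_sum (I : Type) (r : seq I) (P : pred I) (F : I -> R[i]) :
  normc (\sum_(i <- r | P i) F i) <= \sum_(i <- r | P i) normc (F i).
Proof.
elim/big_ind2: _ => [|x a y b xa yb|//].
  by rewrite ComplexField.Normc.normc0.
by rewrite (le_trans (le_normcD _ _))// lerD.
Qed.

Lemma cvg_normc u z : ccvg u z -> (fun n => normc (u n)) @ \oo --> normc z.
Proof.
move=> [ur ui].
have normE y : normc y = Num.sqrt (Re y * Re y + Im y * Im y) by case: y.
rewrite normE; under eq_fun do rewrite normE.
apply: (@cvg_comp _ _ _ _ (@Num.sqrt R)); last exact: sqrt_continuous.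
by apply: cvgD; exact: cvgM.
Qed.

Lemma ccvgV u z : z != 0 -> ccvg u z -> ccvg (fun n => (u n)^-1) z^-1.
Proof.
move=> z0 uz; have [ur ui] := uz.
have ReV y : Re y^-1 = Re y / normc y ^+ 2.
  by rewrite sqr_normc; case: y.
have ImV y : Im y^-1 = - (Im y / normc y ^+ 2).
  by rewrite sqr_normc; case: y.
have nz : normc z ^+ 2 != 0.
  by rewrite expf_eq0/=; apply: contra_neq z0;
    exact: ComplexField.Normc.eq0_normc.
have nV : (fun n => (normc (u n) ^+ 2)^-1) @ \oo --> (normc z ^+ 2)^-1.
  apply: cvgV => //; rewrite expr2; under eq_fun do rewrite expr2.
  by apply: cvgM; exact: cvg_normc.
split.
  by rewrite ReV; under eq_fun do rewrite ReV; exact: cvgM.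
by rewrite ImV; under eq_fun do rewrite ImV; apply: cvgN; exact: cvgM.
Qed.

Definition cexp (a b : R) : R[i] := (expR a * cos b +i* (expR a * sin b))%C.

Lemma cexpD a b c d : cexp (a + c) (b + d) = cexp a b * cexp c d.
Proof.
by apply/eqP; rewrite eq_complex /= expRD cosD sinD; apply/andP; split;
  apply/eqP; ring.
Qed.

Lemma cexp0 : cexp 0 0 = 1.
Proof. by rewrite /cexp expR0 cos0 sin0 mulr0 mul1r. Qed.

Lemma cexpX a b (n : nat) : cexp a b ^+ n = cexp (a *+ n) (b *+ n).
Proof.
elim: n => [|n IHn]; first by rewrite expr0 !mulr0n cexp0.
by rewrite exprS IHn -cexpD -!mulrS.
Qed.

Lemma normc_cexp a b : normc (cexp a b) = expR a.
Proof.
rewrite /= !exprMn -mulrDr cos2Dsin2 mulr1 sqrtr_sqr.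
by rewrite ger0_norm ?expR_ge0.
Qed.

(** Half-angle form of the distance to 1: the argument enters only through [sin (b / 2)], so points
    on one circle are compared by their sines. *)
Lemma sqr_normc_cexp_subr1 a b :
  normc (cexp a b - 1) ^+ 2 =
  (expR a - 1) ^+ 2 + expR a * (2 * sin (b / 2)) ^+ 2.
Proof.
have cosE : cos b = 1 - 2 * sin (b / 2) ^+ 2.
  have -> : cos b = cos (b / 2 + b / 2) by rewrite -splitr.
  by rewrite cosD -!expr2 cos2sin2; ring.
rewrite sqr_normc /= subr0 exprMn (sin2cos2 b) cosE; ring.
Qed.

(** This is the derivative at 0 of [t -> e^(t (a + b i))], sampled at [t = 1 / m.+1]. *)
Lemma cvg_cexp_slope (a b : R) :
  ccvg (fun m : nat => m.+1%:R * (cexp (a / m.+1%:R) (b / m.+1%:R) - 1))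
    (a +i* b)%C.
Proof.
have slope (h : R -> R) (d : R) : is_derive (0 : R) 1 h d ->
    (fun m : nat => m.+1%:R * (h m.+1%:R^-1 - h 0)) @ \oo --> d.
  case=> hd <-.
  have /cvgr_dnbhsP/(_ (fun m => m.+1%:R^-1)) hV := hd.
  rewrite [X in X @ _](_ : _ = fun m : nat => (m.+1%:R^-1)^-1 *:
      ((h \o shift 0) (m.+1%:R^-1 *: (1 : R)) - h 0)); last first.
    by apply/funext => m; rewrite /= invrK [_ *: 1]mulr1 addr0.
  apply: hV; split; last exact: cvg_harmonic.
  by move=> m; rewrite invr_eq0 pnatr_eq0.
have re_d : is_derive (0 : R) 1 (fun t => expR (a * t) * cos (b * t)) a.
  apply: is_derive_eq; rewrite !mulr0 expR0 cos0 sin0 oppr0 mul0r scaler0.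
  by rewrite add0r scale1r mul1r [_%:A]mulr1.
have im_d : is_derive (0 : R) 1 (fun t => expR (a * t) * sin (b * t)) b.
  apply: is_derive_eq; rewrite !mulr0 expR0 cos0 sin0 scale0r addr0.
  by rewrite scale1r mul1r [_%:A]mulr1.
have natE m : m.+1%:R = (m.+1%:R)%:C%C :> R[i] by rewrite rmorph_nat.
split => /=.
  under eq_fun do rewrite ReM natE /= mul0r subr0.
  have := slope _ _ re_d; rewrite !mulr0 expR0 cos0 mulr1; exact.
under eq_fun do rewrite ImM natE /= mul0r addr0 oppr0 addr0.
have := slope _ _ im_d; rewrite !mulr0 sin0 mulr0.
by under eq_fun do rewrite subr0.
Qed.

End ComplexSequences.

(** * The poles of the approximants *)

Section PoleSums.
Variable R : realType.
Local Notation normc := ComplexField.Normc.normc.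

Lemma sin_ge_symmetric (a y : R) :
  0 <= a -> a <= y -> y <= pi - a -> sin a <= sin y.
Proof.
have sin_le (b z : R) : 0 <= b -> b <= z -> z <= pi / 2 -> sin b <= sin z.
  move=> b0 bz zpi; have := pi_ge0 R => ?.
  by rewrite leNgt ltr_sin ?in_itv/= -?leNgt//; lra.
move=> a0 ay yp; have [yh|yh] := leP y (pi / 2); first exact: sin_le.
have -> : sin y = sin (pi - y) by rewrite sinB sinpi cospi; ring.
by apply: sin_le; lra.
Qed.

(** A weak Jordan inequality. Up to [pi / 4] the mean value theorem applies with [cos >= 1 / 2];
    beyond, [sin y >= sin (pi / 4) >= pi / 8 >= y / 4]. *)
Lemma sin_ge_quarter (y : R) : 0 <= y -> y <= pi / 2 -> y / 4 <= sin y.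
Proof.
have pi0 := pi_gt0 R.
have cos_half (c : R) : 0 <= c -> c <= pi / 4 -> 1 / 2 <= cos c.
  move=> c0 c4.
  have sc : sin c <= cos c.
    by rewrite -sinDpihalf; apply: sin_ge_symmetric; lra.
  have cos0 : 0 <= cos c by apply: cos_ge0_pihalf; lra.
  have sin0 : 0 <= sin c by apply: sin_ge0_pi; lra.
  have := cos2Dsin2 c; nra.
have small (z : R) : 0 <= z -> z <= pi / 4 -> z / 2 <= sin z.
  move=> z0 z4.
  have [c] := @MVT_segment R sin cos 0 z z0 (fun x _ => is_derive_sin x)
    (continuous_subspaceT (@continuous_sin R)).
  rewrite in_itv/= => /andP[c0 cz]; rewrite sin0 !subr0 => ->.
  by have := cos_half c c0 (le_trans cz z4); nra.
move=> y0 yh; have [y4|y4] := leP y (pi / 4).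
  by apply: le_trans (small _ y0 y4); lra.
have := @sin_ge_symmetric (pi / 4) y; have := small (pi / 4); lra.
Qed.

(** For [k < N] these are the [N]-th roots of [- expR l]; indices [0] and [N - 1] give the conjugate
    pair nearest to 1. *)
Definition root_w (l : R) (N k : nat) : R[i] :=
  cexp (l / N%:R) (k.*2.+1%:R * pi / N%:R).

(* The poles of [1 / ((1 + s / N) ^+ N + expR l)]. *)
Definition pole (l : R) (N k : nat) : R[i] := N%:R * (root_w l N k - 1).

Lemma root_wX (l : R) (N k : nat) :
  (0 < N)%N -> root_w l N k ^+ N = (- expR l)%:C%C.
Proof.
move=> N0; have N0' : N%:R != 0 :> R by rewrite pnatr_eq0 -lt0n.
rewrite cexpX -(mulr_natr (l / _)) -(mulr_natr (_ * pi / _)) !divfK//.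
rewrite -{1}[l]addr0 -[X in cexp _ X]add0r cexpD.
rewrite -[X in _ * cexp X _](mul0rn _ k.*2.+1) mulr_natl -cexpX.
have -> : cexp 0 pi = -1 :> R[i].
  by apply/eqP; rewrite eq_complex/= expR0 cospi sinpi !mul1r oppr0 !eqxx.
rewrite -signr_odd/= odd_double expr1 mulrN1.
by apply/eqP; rewrite eq_complex/= cos0 sin0 mulr1 mulr0 oppr0 !eqxx.
Qed.

Lemma normc_pole_gt (l : R) (N k : nat) : (k < N)%N -> 0 < normc (pole l N k).
Proof.
move=> kN; have N0 : 0 < N%:R :> R by rewrite ltr0n (leq_ltn_trans _ kN).
rewrite ComplexField.Normc.normcM mulr_gt0//.
  by rewrite -(rmorph_nat (real_complex R)) normc_real gtr0_norm.
rewrite lt0r normc_ge0 andbT -sqrf_eq0 sqr_normc_cexp_subr1.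
have s0 : 0 < sin (k.*2.+1%:R * pi / N%:R / 2) :> R.
  apply: sin_gt0_pi; have := pi_gt0 R => pi0.
  rewrite divr_gt0 ?divr_gt0 ?mulr_gt0//= ltr_pdivrMr// ltr_pdivrMr//.
  rewrite mulrC -mulrA ltr_pM2l// -natrM ltr_nat; lia.
by rewrite gt_eqF// ltr_wpDl ?sqr_ge0// mulr_gt0 ?expR_gt0// exprn_gt0//
  mulr_gt0.
Qed.

Lemma root_w_neq1 (l : R) (N k : nat) : (k < N)%N -> root_w l N k != 1.
Proof.
move=> /(normc_pole_gt l); apply: contraTneq => w1.
by rewrite /pole w1 subrr mulr0 ComplexField.Normc.normc0 ltxx.
Qed.

(** A geometric sum of ratio [z = e^(2 pi i p / N)], which vanishes because [z ^+ N = 1] and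
    [z != 1]. *)
Lemma sum_root_wX (l : R) (N p : nat) :
  (0 < p < N)%N -> \sum_(k < N) root_w l N k ^+ p = 0.
Proof.
move=> /andP[p0 pN]; have N0 : N%:R != 0 :> R by rewrite pnatr_eq0; lia.
pose z := cexp (0 : R) (2 * pi / N%:R) ^+ p.
have wE (k : nat) : root_w l N k ^+ p = root_w l N 0 ^+ p * z ^+ k.
  rewrite -exprM mulnC exprM -exprMn; congr (_ ^+ _).
  rewrite cexpX -cexpD mul0rn addr0; congr cexp.
  by rewrite -(mulr_natr (_ / _) k) double0 -addn1 -muln2 natrD natrM; field.
under eq_bigr do rewrite wE.
rewrite -mulr_sumr; apply/eqP; rewrite mulf_eq0; apply/orP; right.
have : (z - 1) * \sum_(k < N) z ^+ k == 0.
  rewrite -subrX1 -exprM mulnC exprM cexpX mul0rn -(mulr_natr (_ / _) N)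
    divfK//.
  rewrite subr_eq0; apply/eqP; rewrite -[RHS](expr1n _ p); congr (_ ^+ _).
  rewrite mulr_natl; apply/eqP.
  by rewrite eq_complex/= expR0 cos2pi sin2pi !mul1r !eqxx.
rewrite mulf_eq0 => /orP[|//]; rewrite subr_eq0 /z cexpX mul0rn => /eqP z1.
(* If [z] were 1, the half-angle formula would force [sin (pi p / N) = 0], which [0 < p < N]
   excludes. *)
have := sqr_normc_cexp_subr1 0 ((2 * pi / N%:R : R) *+ p).
rewrite z1 subrr ComplexField.Normc.normc0 expr0n/= expR0 subrr expr0n/=.
rewrite add0r mul1r => /esym/eqP.
rewrite sqrf_eq0 mulf_eq0 pnatr_eq0/= gt_eqF//.
have := pi_gt0 R => pi0; have N0' : 0 < N%:R :> R by rewrite ltr0n; lia.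
apply: sin_gt0_pi; rewrite -(mulr_natr _ p); apply/andP; split.
  by rewrite divr_gt0// mulr_gt0 ?ltr0n// divr_gt0// mulr_gt0.
have -> : 2 * pi / N%:R * p%:R / 2 = pi * (p%:R / N%:R) :> R by field.
by rewrite gtr_pMr// ltr_pdivrMr// mul1r ltr_nat.
Qed.

End PoleSums.

(** * Bounds on the distant poles, uniform in the number of poles *)

Section Tail.
Variable R : realType.
Local Notation normc := ComplexField.Normc.normc.

Lemma sqr_normc_pole (l : R) (N k : nat) :
  normc (pole l N k) ^+ 2 =
  N%:R ^+ 2 * ((expR (l / N%:R) - 1) ^+ 2 +
    expR (l / N%:R) * (2 * sin (k.*2.+1%:R * pi / N%:R / 2)) ^+ 2).
Proof.
rewrite /pole ComplexField.Normc.normcM exprMn sqr_normc_cexp_subr1.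
by rewrite -(rmorph_nat (real_complex R)) normc_real normr_nat.
Qed.

(** With [N = M.+1], the range of [k] omits the nearest pair [0] and [M]. The other half-arguments
    lie between that of index 1 and its reflection in [pi / 2], where the sine is at least its
    endpoint value. *)
Lemma normc_pole_ge1 (l : R) (M k : nat) : (0 < k < M)%N ->
  normc (pole l M.+1 1) <= normc (pole l M.+1 k).
Proof.
move=> /andP[k0 kM]; rewrite -ler_sqr ?nnegrE ?normc_ge0// !sqr_normc_pole.
rewrite ler_wpM2l ?sqr_ge0// lerD2l ler_wpM2l ?expR_ge0//.
have pi0 := pi_gt0 R; have N0 : 0 < M.+1%:R :> R by rewrite ltr0n.
have le_angle (a b : nat) : (a <= b)%N ->
    a%:R * pi / M.+1%:R / 2 <= b%:R * pi / M.+1%:R / 2 :> R.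
  by move=> ab; rewrite !ler_pM2r ?invr_gt0// ler_nat.
have angle0 (a : nat) : 0 <= a%:R * pi / M.+1%:R / 2 :> R.
  by rewrite !divr_ge0// mulr_ge0// pi_ge0.
have anglepi : 3%:R * pi / M.+1%:R / 2 <= pi :> R.
  rewrite ler_pdivrMr// ler_pdivrMr// mulrC -mulrA ler_pM2l// -natrM ler_nat.
  lia.
have piE : pi = M.+1.*2%:R * pi / M.+1%:R / 2 :> R.
  by rewrite -muln2 natrM; field; rewrite ?nat1r ?natr1 pnatr_eq0.
have sin1 : 0 <= sin (3%:R * pi / M.+1%:R / 2) :> R.
  by apply: sin_ge0_pi; rewrite angle0.
have sin1k : sin (3%:R * pi / M.+1%:R / 2) <=
    sin (k.*2.+1%:R * pi / M.+1%:R / 2) :> R.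
  apply: sin_ge_symmetric => //; first by apply: le_angle; lia.
  rewrite [X in X - _]piE lerBrDr -!mulrDl -natrD; apply: le_angle; lia.
apply: lerXn2r; rewrite ?nnegrE ?ler_pM2l// mulr_ge0//.
exact: le_trans sin1k.
Qed.

(* [1 / k - 1 / k.+1] is a telescoping majorant of [4 / (2 k + 1) ^ 2], and
   [2 k + 1] is, up to a constant, the distance from the angle to a multiple
   of [2 pi]. *)
Lemma root_w_pole_le (l : R) (M k : nat) : (0 < k < M)%N ->
  expR (l / M.+1%:R) / normc (pole l M.+1 k) ^+ 2 <=
  (k%:R^-1 - k.+1%:R^-1) + ((M - k)%:R^-1 - (M - k).+1%:R^-1).
Proof.
move=> /andP[k0 kM].
have pi2 := pi_ge2 R; have N0 : 0 < M.+1%:R :> R by rewrite ltr0n.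
have gap0 (d : nat) : (0 < d)%N -> 0 <= d%:R^-1 - d.+1%:R^-1 :> R.
  by move=> d0; rewrite subr_ge0 lef_pV2 ?posrE ?ltr0n// ler_nat.
(* Here [d] is [k] or the mirror index [M - k], whichever has half-argument at most [pi / 2]; both
   give the same sine. *)
have bound (d : nat) : (0 < d)%N ->
    d.*2.+1%:R * pi / M.+1%:R / 2 <= pi / 2 :> R ->
    sin (k.*2.+1%:R * pi / M.+1%:R / 2) =
      sin (d.*2.+1%:R * pi / M.+1%:R / 2) :> R ->
    expR (l / M.+1%:R) / normc (pole l M.+1 k) ^+ 2 <=
      d%:R^-1 - d.+1%:R^-1.
  move=> d0 dpi sE.
  have e0 := expR_gt0 (l / M.+1%:R).
  have dR : 0 < d%:R :> R by rewrite ltr0n.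
  (* From [sin y >= y / 4] and [pi >= 2], [M.+1 * (2 * sin y) >= (2 d + 1) / 2], whose square
     exceeds [d (d + 1)]. *)
  have low : expR (l / M.+1%:R) * (d%:R * d.+1%:R) <=
      normc (pole l M.+1 k) ^+ 2.
    rewrite sqr_normc_pole sE; set y := _ / 2.
    have y0 : 0 <= y by rewrite !divr_ge0// mulr_ge0// (le_trans _ pi2).
    have siny : y / 4 <= sin y by exact: sin_ge_quarter.
    have yN : d.*2.+1%:R / 4 <= M.+1%:R * (y / 4).
      have -> : M.+1%:R * (y / 4) = d.*2.+1%:R * (pi / 8).
        by rewrite /y; field; rewrite ?nat1r ?natr1 pnatr_eq0.
      by rewrite ler_wpM2l//; lra.
    have : d.*2.+1%:R / 2 <= M.+1%:R * (2 * sin y) by nra.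
    rewrite -ler_sqr ?nnegrE; last 2 first.
    - by rewrite divr_ge0.
    - by rewrite !mulr_ge0// (le_trans _ siny)// divr_ge0.
    move=> sq; rewrite mulrDr ler_wpDl//; first by rewrite mulr_ge0 ?sqr_ge0.
    rewrite [leRHS]mulrCA (ler_pM2l e0) -exprMn (le_trans _ sq)//.
    rewrite -[d.+1]addn1 -[d.*2.+1]addn1 -muln2 !natrD natrM; nra.
  have gapE : d%:R^-1 - d.+1%:R^-1 = (d%:R * d.+1%:R)^-1 :> R.
    by rewrite -[d.+1]addn1 natrD; field; rewrite !gt_eqF ?addr_gt0.
  rewrite gapE ler_pdivrMr ?(lt_le_trans _ low) ?mulr_gt0//.
  by rewrite [leRHS]mulrC ler_pdivlMr ?mulr_gt0.
have [kh|kh] := leP (k.*2.+1%:R * pi / M.+1%:R / 2) (pi / 2 : R).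
  by rewrite ler_wpDr ?bound ?gap0//; lia.
have yE : (M - k).*2.+1%:R * pi / M.+1%:R / 2 =
    pi - k.*2.+1%:R * pi / M.+1%:R / 2 :> R.
  apply/eqP; rewrite -subr_eq0 opprB addrA.
  rewrite [X in X == 0](_ : _ =
    ((M - k).*2.+1 + k.*2.+1)%:R * pi / M.+1%:R / 2 - pi); last first.
    by rewrite natrD; ring.
  have -> : ((M - k).*2.+1 + k.*2.+1 = M.+1 * 2)%N by lia.
  by rewrite natrM; apply/eqP; field; rewrite ?nat1r ?natr1 pnatr_eq0.
rewrite ler_wpDl ?gap0 ?bound//; [lia| |].
  by rewrite yE lerBlDr [leLHS]splitr lerD2l ltW.
by rewrite yE sinB sinpi cospi; ring.
Qed.

Lemma sum_gap_le1 (M : nat) :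
  \sum_(1 <= k < M) (k%:R^-1 - k.+1%:R^-1 : R) <= 1.
Proof.
case: M => [|M]; first by rewrite big_geq.
under eq_bigr do rewrite -opprB -[X in X - _]/((fun k => k%:R^-1) _.+1).
rewrite sumrN (telescope_sumr (fun k => k%:R^-1))//.
by rewrite invr1 opprB gerBl invr_ge0.
Qed.

(** Two of the [e.+2] factors pay for a summable majorant, two telescoping sums of at most 1 each;
    the other [e] are bounded through the nearest remaining pole, of index 1. *)
Lemma pole_tail_le (l : R) (M e : nat) :
  normc (\sum_(1 <= k < M) root_w l M.+1 k / pole l M.+1 k ^+ e.+2) <=
  2 / normc (pole l M.+1 1) ^+ e.
Proof.
have [M2|M2] := ltnP M 2.
  rewrite big_geq// ComplexField.Normc.normc0 divr_ge0// exprn_ge0//.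
  exact: normc_ge0.
have s1 : 0 < normc (pole l M.+1 1) by apply: normc_pole_gt; lia.
apply: le_trans (normc_sum _ _ _) _.
apply: (@le_trans _ _ (\sum_(1 <= k < M)
    ((k%:R^-1 - k.+1%:R^-1) + ((M - k)%:R^-1 - (M - k).+1%:R^-1)) /
      normc (pole l M.+1 1) ^+ e)).
  rewrite !big_nat; apply: ler_sum => k /andP[k0 kM].
  rewrite ComplexField.Normc.normcM ComplexField.Normc.normcV normcX.
  have sk : 0 < normc (pole l M.+1 k) by apply: normc_pole_gt; lia.
  rewrite normc_cexp -addn2 addnC exprD invfM mulrA.
  apply: ler_pM.
  - by rewrite divr_ge0 ?expR_ge0 ?sqr_ge0.
  - by rewrite invr_ge0 exprn_ge0 ?ltW.
  - by apply: root_w_pole_le; rewrite k0.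
  - rewrite lef_pV2 ?posrE ?exprn_gt0//.
    by rewrite lerXn2r ?nnegrE ?normc_ge0// normc_pole_ge1 ?k0.
rewrite -mulr_suml ler_wpM2r ?invr_ge0 ?exprn_ge0 ?normc_ge0//.
rewrite big_split/= [X in _ + X]big_nat_rev/= [X in _ + X]big_nat.
rewrite [X in _ + X](eq_bigr (fun k => k%:R^-1 - k.+1%:R^-1)); last first.
  by move=> k /andP[k0 kM]; congr (_%:R^-1 - _%:R^-1); lia.
by rewrite -big_nat; exact: lerD (sum_gap_le1 M) (sum_gap_le1 M).
Qed.

End Tail.

(** * Limit of the pole sums *)

Section PoleSumLimit.
Variable R : realType.
Local Notation normc := ComplexField.Normc.normc.

(** Raising [m] by one multiplies the quotient by [(1 - m / N.+1) / m.+1]. The limit turns the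
    binomial weights of the finite recurrence into inverse factorials. *)
Lemma cvg_bin_div_expr (m : nat) :
  (fun N : nat => 'C(N.+1, m)%:R / N.+1%:R ^+ m : R) @ \oo --> (m`!%:R^-1 : R).
Proof.
elim: m => [|m IHm].
  by under eq_fun do rewrite bin0 expr0 divr1; rewrite fact0 invr1;
    exact: cvg_cst.
rewrite [X in X @ _](_ : _ = fun N : nat =>
    'C(N.+1, m)%:R / N.+1%:R ^+ m * (1 - m%:R * N.+1%:R^-1) * m.+1%:R^-1);
    last first.
  apply/funext => N.
  have binS : m.+1%:R * 'C(N.+1, m.+1)%:R = (N.+1%:R - m%:R) * 'C(N.+1, m)%:R
    :> R.
    rewrite -natrM mul_bin_left; have [mN|Nm] := leqP m N.+1.
      by rewrite natrM natrB.
    by rewrite bin_small// muln0 mulr0.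
  have NE : 1 - m%:R * N.+1%:R^-1 = (N.+1%:R - m%:R) / N.+1%:R :> R.
    by rewrite mulrBl divff ?pnatr_eq0.
  apply: (@mulfI _ m.+1%:R); first by rewrite pnatr_eq0.
  rewrite mulrA binS NE exprS; field.
  by rewrite ?natr1 ?nat1r ?expf_neq0 ?pnatr_eq0.
rewrite factS natrM invfM mulrC; apply: cvgMl.
rewrite -[X in _ --> X]mulr1; apply: cvgM => //.
rewrite -[X in _ --> X]subr0; apply: cvgB; first exact: cvg_cst.
by rewrite -(mulr0 m%:R); apply: cvgMr; exact: cvg_harmonic.
Qed.

(* The [n]-th Taylor coefficient of [expR l / ((1 + s / N) ^+ N + expR l)]
   at [s = 0]. *)
Definition pole_sum (l : R) (n N : nat) : R[i] :=
  \sum_(k < N) root_w l N k / pole l N k ^+ n.+1.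

(** This is [partial_fraction_recurrence] divided by [N ^+ n.+1], each pole being [N] times
    [w - 1]. *)
Lemma pole_sum_recurrence (l : R) (n N : nat) : (n < N)%N ->
  \sum_(j < n.+1) ('C(N, n - j)%:R / N%:R ^+ (n - j)) * pole_sum l j N
    - (- expR l)%:C%C * pole_sum l n N
  = - (if n == 0 then (- expR l)%:C%C else 0).
Proof.
move=> nN; have N0 : N%:R != 0 :> R[i] by rewrite pnatr_eq0; lia.
pose S j := \sum_(k < N) root_w l N k / (root_w l N k - 1) ^+ j.+1.
have sumE j : pole_sum l j N = S j / N%:R ^+ j.+1.
  rewrite /S mulr_suml; apply: eq_bigr => k _.
  by rewrite /pole exprMn invfM mulrA mulrAC.
have := partial_fraction_recurrence nN
  (fun k => root_wX l k (leq_ltn_trans (leq0n n) nN))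
  (@root_w_neq1 _ l N) (@sum_root_wX _ l N).
rewrite -!/(S _) => rec; rewrite sumE mulrA.
have -> : - (if n == 0 then (- expR l)%:C%C else 0 : R[i]) =
    - (if n == 0 then N%:R * (- expR l)%:C%C else 0) / N%:R ^+ n.+1.
  by case: eqP => [->|_]; rewrite ?oppr0 ?mul0r// expr1 -mulrN mulrAC divff//
    mul1r.
rewrite -rec mulrBl; congr (_ - _).
rewrite mulr_suml; apply: eq_bigr => j _; rewrite -/(S _) sumE.
rewrite [X in _ = _ / _ ^+ X](_ : _ = (n - j + j.+1)%N); last first.
  by rewrite addnS subnK ?leq_ord.
by rewrite exprD invfM mulrACA.
Qed.

(** Both recurrences can be solved for their [n]-th term, since [1 - x = 1 + expR l] is nonzero.
    Strong induction then carries the limit over: the earlier terms and the binomial weights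
    converge. *)
Lemma ccvg_pole_sum (l : R) (v : nat -> R) :
  (forall n, \sum_(j < n.+1) v j / (n - j)`!%:R - (- expR l) * v n =
     - (if n == 0 then - expR l else 0)) ->
  forall n, ccvg (fun M => pole_sum l n M.+1) (v n)%:C%C.
Proof.
move=> vrec; elim/ltn_ind => n IHn.
pose x := (- expR l)%:C%C : R[i].
have x1 : 1 - x != 0.
  by rewrite eq_complex/= opprK gt_eqF// addr_gt0// expR_gt0.
pose rhs := - (if n == 0 then x else 0).
have vE : (v n)%:C%C =
    (rhs - \sum_(j < n) (n - j)`!%:R^-1%:C%C * (v j)%:C%C) / (1 - x).
  apply: (mulIf x1); rewrite divfK//; have := vrec n.
  rewrite big_ord_recr/= subnn fact0 divr1 => /(congr1 (real_complex R)).
  rewrite rmorphB rmorphD rmorphN rmorphM rmorph_sum/=.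
  rewrite (fun_if (real_complex R))/= rmorph0 -/x -/rhs => <-.
  under eq_bigr do rewrite rmorphM/= mulrC.
  by ring.
have PE : \forall M \near \oo,
    (rhs - \sum_(j < n) ('C(M.+1, n - j)%:R / M.+1%:R ^+ (n - j))%:C%C *
       pole_sum l j M.+1) / (1 - x) = pole_sum l n M.+1.
  exists n => // M /= nM; have := pole_sum_recurrence l (leq_ltn_trans nM
    (ltnSn M)).
  rewrite big_ord_recr/= subnn bin0 expr0 divr1 mul1r -/x -/rhs => <-.
  apply: (mulIf x1); rewrite divfK//.
  under [X in _ - X]eq_bigr do rewrite fmorph_div rmorphXn !rmorph_nat.
  by ring.
rewrite vE.
have near_ccvg (u w : nat -> R[i]) z :
    {near \oo, u =1 w} -> ccvg u z -> ccvg w z.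
  move=> uw [ur ui]; split.
    by apply: cvg_trans ur; apply: near_eq_cvg; apply: filterS uw => M /= ->.
  by apply: cvg_trans ui; apply: near_eq_cvg; apply: filterS uw => M /= ->.
apply: near_ccvg PE _; apply: ccvgM; last exact: ccvg_cst.
apply: ccvgD; first exact: ccvg_cst.
apply/ccvgN/ccvg_sum => j; apply: ccvgM; last exact: IHn.
exact/ccvg_real/cvg_bin_div_expr.
Qed.

End PoleSumLimit.

(** * The recurrence of the Eulerian polynomials *)

Section TaylorRemainders.
Variable R : realType.
Implicit Types (f g : R -> R) (p : {poly R}).

(** The neighbourhood is punctured so that such bounds can be divided by [t]. *)
Definition bigO0 (m : nat) f :=
  exists C : R, \forall t \near (0 : R)^', `|f t| <= C * `|t| ^+ m.

Lemma eq_bigO0 m f g : f =1 g -> bigO0 m f -> bigO0 m g.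
Proof. by move=> /funext->. Qed.

Lemma bigO0D m f g : bigO0 m f -> bigO0 m g -> bigO0 m (fun t => f t + g t).
Proof.
move=> [C fC] [D gD]; exists (C + D); near=> t.
rewrite mulrDl (le_trans (ler_normD _ _))// lerD//; near: t;
  [exact: fC|exact: gD].
Unshelve. all: by end_near. Qed.

Lemma bigO0M m k f g :
  bigO0 m f -> bigO0 k g -> bigO0 (m + k) (fun t => f t * g t).
Proof.
move=> [C fC] [D gD]; exists (C * D); near=> t.
rewrite normrM exprD mulrACA ler_pM//; near: t; [exact: fC|exact: gD].
Unshelve. all: by end_near. Qed.

Lemma bigO0_id : bigO0 1 id.
Proof. by exists 1; near=> t; rewrite mul1r expr1. Unshelve. all: by end_near.
  Qed.

Lemma bigO0_cst (c : R) : bigO0 0 (fun=> c).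
Proof. by exists `|c|; near=> t; rewrite expr0 mulr1. Unshelve. all: by
  end_near. Qed.

Lemma bigO0W m k f : (k <= m)%N -> bigO0 m f -> bigO0 k f.
Proof.
move=> km [C fC]; exists `|C|; near=> t.
apply: (@le_trans _ _ (C * `|t| ^+ m)); first by near: t; exact: fC.
apply: (@le_trans _ _ (`|C| * `|t| ^+ m)).
  by rewrite ler_wpM2r ?exprn_ge0 ?ler_norm.
rewrite ler_wpM2l// ler_wiXn2l//; near: t.
by apply: filterS (@dnbhs0_lt _ R _ ltr01) => t /ltW.
Unshelve. all: by end_near. Qed.

Lemma bigO0_horner p : bigO0 0 (horner p).
Proof.
elim/poly_ind: p => [|p c IHp].
  by apply: eq_bigO0 (bigO0_cst 0) => t; rewrite horner0.
apply: (eq_bigO0 (f := fun t => p.[t] * t + c)).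
  by move=> t; rewrite hornerMXaddC.
apply: bigO0D (bigO0_cst c); apply: (@bigO0W 1) => //.
exact: (bigO0M IHp bigO0_id).
Qed.

Lemma bigO0_cst_eq0 (c : R) : bigO0 1 (fun=> c) -> c = 0.
Proof.
case=> C cC; apply/eqP; rewrite -normr_eq0 eq_le normr_ge0 andbT.
have lim0 : C * `|t| @[t --> (0 : R)^'] --> (0 : R).
  rewrite -[X in _ --> X](mulr0 C); apply: cvgMr.
  rewrite -[X in _ --> X](@normr0 _ R); apply: cvg_norm => B.
  exact: nbhs_dnbhs.
apply: (ler_cvg_to (cvg_cst `|c|) lim0).
by apply: filterS cC => t; rewrite expr1.
Qed.

(** Letting [t] tend to 0 kills the constant term; dividing by [t] then lowers [m]. *)
Lemma bigO0_coef0 p m i : bigO0 m (horner p) -> (i < m)%N -> p`_i = 0.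
Proof.
elim: m p i => [//|m IHm] p i.
elim/poly_ind: p => [|q c _]; first by rewrite coef0.
have hornerE t : (q * 'X + c%:P).[t] = q.[t] * t + c by rewrite hornerMXaddC.
move=> pO; have c0 : c = 0.
  apply: bigO0_cst_eq0.
  apply: (eq_bigO0 (f := fun t => (q * 'X + c%:P).[t] + - q.[t] * t)).
    by move=> t; rewrite hornerE mulNr addrAC subrr add0r.
  apply: bigO0D; first exact: (bigO0W (m := m.+1)).
  apply: (bigO0M (m := 0)) bigO0_id.
  by apply: eq_bigO0 (bigO0_horner (- q)) => t; rewrite hornerN.
have qO : bigO0 m (horner q).
  case: pO => C pC; exists C; near=> t.
  have t0 : t != 0 by near: t; exact: nbhs_dnbhs_neq.
  rewrite -(@ler_pM2r _ `|t|) ?normr_gt0// -normrM -mulrA -exprSr.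
  have -> : q.[t] * t = (q * 'X + c%:P).[t] by rewrite hornerE c0 addr0.
  by near: t; exact: pC.
rewrite c0 polyC0 addr0 coefMX; case: i => [//|i] /= im.
exact: IHm.
Unshelve. all: by end_near. Qed.

(** Convergence at one [t0 > 0] bounds the terms there by some [B]; for [|t| <= t0 / 2] the tail is
    dominated by a geometric series. *)
Lemma pseries_bigO0 (c : nat -> R) f (m : nat) :
  (\forall t \near (0 : R),
    series (fun n => c n * t ^+ n) @ \oo --> f t) ->
  bigO0 m (fun t => f t - \sum_(j < m) c j * t ^+ j).
Proof.
move=> cf; have [e/= e0 cfe] := cf.
have [t0 t00 t0e] : exists2 t0, 0 < t0 & t0 < e by exists (e / 2); lra.
have cvgS : cvgn (series (fun n => c n * t0 ^+ n)).
  apply/cvg_ex; exists (f t0); apply: cfe => /=.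
  by rewrite sub0r normrN gtr0_norm.
have [B _ cB] := ex_strict_bound_gt0 (cvg_series_bounded cvgS).
have {}cB n : `|c n| * t0 ^+ n <= B.
  by have := cB n I; rewrite /= normrM normrX (gtr0_norm t00) => /ltW.
(* The factor 2 bounds [1 / (1 - r)] for the ratio [r = |t| / t0 <= 1 / 2]. *)
exists (2 * B / t0 ^+ m); near=> t.
have te : `|t| <= t0 / 2.
  near: t; have t02 : 0 < t0 / 2 by rewrite divr_gt0.
  by apply: filterS (@dnbhs0_lt _ R _ t02) => t /ltW.
have ft : series (fun n => c n * t ^+ n) @ \oo --> f t.
  by near: t; exact: nbhs_dnbhs.
pose s := \sum_(j < m) c j * t ^+ j.
have lims : `|series (fun n => c n * t ^+ n) n - s| @[n --> \oo] --> `|f t - s|.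
  by apply: cvg_norm; apply: cvgB => //; exact: cvg_cst.
apply: (ler_cvg_to lims (cvg_cst _)); exists m => // n /= mn.
rewrite /series/= (@big_cat_nat _ _ _ m)//= big_mkord addrAC subrr add0r.
pose r := `|t| / t0; have r0 : 0 <= r by rewrite divr_ge0// ltW.
have r2 : r <= 1 / 2 by rewrite ler_pdivrMr// mulrC mul1r.
have term j : `|c j * t ^+ j| <= B * r ^+ j.
  rewrite normrM normrX expr_div_n mulrA ler_pdivlMr ?exprn_gt0//.
  by rewrite mulrAC ler_wpM2r ?exprn_ge0.
apply: le_trans (ler_norm_sum _ _ _) _.
apply: le_trans (ler_sum _ (fun j _ => term j)) _.
have B0 : 0 <= B by apply: le_trans (cB 0); rewrite mulr_ge0// exprn_ge0 ?ltW.
have -> : 2 * B / t0 ^+ m * `|t| ^+ m = B * (2 * r ^+ m).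
  by rewrite /r expr_div_n; ring.
rewrite -mulr_sumr ler_wpM2l//.
have geo : (1 - r) * \sum_(m <= j < n) r ^+ j = r ^+ m - r ^+ n.
  rewrite mulr_sumr -(opprB (r ^+ n)) -(telescope_sumr (fun j => r ^+ j) mn).
  by rewrite -sumrN; apply: eq_bigr => j _; rewrite exprS; ring.
have S0 : 0 <= \sum_(m <= j < n) r ^+ j by apply: sumr_ge0 => j _;
  exact: exprn_ge0.
have := exprn_ge0 n r0; nra.
Unshelve. all: by end_near. Qed.

End TaylorRemainders.

(** Multiplied by its denominator, the generating identity reads [f * g = 1 - x]. Replacing [f] and
    [g] by their Taylor polynomials [P] and [Q] costs O(t^(n+1)), so [P * Q] and [1 - x] have the
    same [n]-th coefficient. *)
Lemma eulerian_recurrence (R : realType) (A : nat -> {poly R}) (x : R) :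
  is_eulerian A -> x < 0 ->
  let v n := x * (A n).[x] / (n`!%:R * (x - 1) ^+ n.+1) in
  forall n, \sum_(j < n.+1) v j / (n - j)`!%:R - x * v n
    = - (if n == 0 then x else 0).
Proof.
move=> eulA x0 v n; pose y := x - 1.
have y0 : y != 0 by rewrite /y; lra.
pose a j := (A j).[x] / j`!%:R.
pose P := \poly_(j < n.+1) a j.
pose Q := \poly_(j < n.+1) (y ^+ j / j`!%:R) - x%:P.
pose g t := expR (t * y) - x.
pose f t := (1 - x) / g t.
have g0 t : g t != 0 by rewrite /g; have := expR_gt0 (t * y); lra.
have fO : bigO0 n.+1 (fun t => f t - P.[t]).
  apply: (eq_bigO0 (f := fun t => f t - \sum_(j < n.+1) a j * t ^+ j)).
    by move=> t; rewrite horner_poly.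
  apply: pseries_bigO0; have x1 : x != 1 by lra.
  apply: filterS (eulA x x1) => t.
  rewrite (_ : (fun j => _ * (t ^+ j / _)) = fun j => a j * t ^+ j)//.
  by apply/funext => j; rewrite /a mulrAC mulrA.
have gO : bigO0 n.+1 (fun t => g t - Q.[t]).
  apply: (eq_bigO0 (f := fun t => expR (t * y) -
      \sum_(j < n.+1) y ^+ j / j`!%:R * t ^+ j)).
    by move=> t; rewrite /g /Q !hornerE horner_poly; ring.
  apply: (pseries_bigO0 (c := fun j => y ^+ j / j`!%:R)
    (f := fun t => expR (t * y))); near=> t.
  rewrite (_ : (fun j => _ * t ^+ j) = exp_coeff (t * y)).
    exact: is_cvg_series_exp_coeff.
  by apply/funext => j; rewrite /exp_coeff/= exprMn; ring.
have PQO : bigO0 n.+1 (horner (P * Q - (1 - x)%:P)).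
  (* [P Q - f g = - P (g - Q) - (f - P) g]: the two remainders with bounded factors. *)
  apply: (eq_bigO0 (f := fun t =>
      (- P.[t]) * (g t - Q.[t]) + (f t - P.[t]) * - g t)).
    by move=> t; rewrite !hornerE /f; field.
  have PO := bigO0_horner (- P); have QO := bigO0_horner (- Q).
  apply: bigO0D.
    apply: (bigO0M (m := 0)) gO.
    by apply: eq_bigO0 PO => t; rewrite hornerN.
  rewrite -(addn0 n.+1); apply: bigO0M fO _.
  apply: (eq_bigO0 (f := fun t => -1 * (g t - Q.[t]) + (- Q).[t])).
    by move=> t; rewrite hornerN; ring.
  apply: bigO0D QO; apply: (bigO0M (m := 0)) (bigO0_cst _) _.
  exact: bigO0W gO.
have := bigO0_coef0 PQO (ltnSn n).
rewrite coefB coefC coefM => /eqP; rewrite subr_eq0 => /eqP coefPQ.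
have aE : \sum_(j < n.+1) a j * (y ^+ (n - j) / (n - j)`!%:R) - x * a n =
    if n == 0 then 1 - x else 0.
  rewrite -coefPQ !big_ord_recr/= !coefB !coefC !coef_poly ltnSn subnn/=.
  rewrite [X in _ = X + _](eq_bigr
      (fun j : 'I_n => a j * (y ^+ (n - j) / (n - j)`!%:R))); last first.
    move=> j _; rewrite !coefB !coefC !coef_poly ltnS ltnW ?ltn_ord//.
    rewrite ltnS leq_subr subn_eq0 leqNgt ltn_ord/= subr0//.
  by rewrite expr0; ring.
have vE j : v j = x * a j / y ^+ j.+1.
  by rewrite /v /a -/y invfM; ring.
(* Scaling by [x / y ^+ n.+1] turns [a] into [v]; at [n = 0] the right side becomes
   [(1 - x) * x / (x - 1) = - x]. *)
transitivity ((\sum_(j < n.+1) a j * (y ^+ (n - j) / (n - j)`!%:R) - x * a n) *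
    (x / y ^+ n.+1)).
  rewrite mulrBl mulr_suml; congr (_ - _); last by rewrite vE; ring.
  apply: eq_bigr => j _; rewrite vE.
  rewrite [in RHS](_ : y ^+ n.+1 = y ^+ (n - j) * y ^+ j.+1); last first.
    by rewrite -exprD addnS subnK ?leq_ord.
  by field; rewrite !expf_neq0 ?pnatr_eq0 -?lt0n ?fact_gt0.
rewrite aE; case: eqP => [->|_]; last by rewrite mul0r oppr0.
by rewrite expr1 /y; field.
Unshelve. all: by end_near. Qed.

(** * Main terms and remainder *)

Section MainTerms.
Variable R : realType.
Local Notation normc := ComplexField.Normc.normc.

Lemma ccvg_pole_fixed (l : R) (k : nat) :
  ccvg (fun M => pole l M.+1 k) (l +i* (k.*2.+1%:R * pi))%C.
Proof. exact: cvg_cexp_slope. Qed.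

(** The last root has argument [2 pi - pi / M.+1], which periodicity replaces by [- pi / M.+1]. *)
Lemma ccvg_pole_last (l : R) : ccvg (fun M => pole l M.+1 M) (l -i* pi)%C.
Proof.
apply: eq_ccvg (cvg_cexp_slope l (- pi)) => M.
rewrite /pole /root_w; congr (_ * (_ - 1)).
have period : cexp 0 (- (2 * pi)) = 1 :> R[i].
  apply/eqP; rewrite eq_complex/= expR0 !mul1r cosN sinN mulr_natl.
  by rewrite cos2pi sin2pi oppr0 !eqxx.
rewrite -[RHS]mulr1 -period.
rewrite -cexpD addr0; congr cexp.
have -> : M.*2.+1%:R = 2 * M.+1%:R - 1 :> R.
  by rewrite -[M.+1]addn1 -[M.*2.+1]addn1 -muln2 !natrD natrM; ring.
by field; rewrite ?natr1 ?nat1r pnatr_eq0.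
Qed.

(** The numerator tends to 1, being [1 + pole / M.+1] with a convergent pole. The index may move
    with [M], which covers the last pole as well as the first. *)
Lemma ccvg_main_term (l : R) (k : nat -> nat) (z : R[i]) (n : nat) :
  z != 0 -> ccvg (fun M => pole l M.+1 (k M)) z ->
  ccvg (fun M => root_w l M.+1 (k M) / pole l M.+1 (k M) ^+ n) (z ^+ n)^-1.
Proof.
move=> z0 kz; rewrite -[(z ^+ n)^-1]mul1r; apply: ccvgM; last first.
  by apply: ccvgV; [rewrite expf_neq0|exact: ccvgX].
rewrite [X in ccvg _ X](_ : _ = 1 + 0%:C%C * z); last first.
  by rewrite rmorph0 mul0r addr0.
apply: (@eq_ccvg _ (fun M =>
    1 + (M.+1%:R^-1 : R)%:C%C * pole l M.+1 (k M))).
  move=> M; rewrite /pole fmorphV rmorph_nat mulrA mulVf ?pnatr_eq0// mul1r.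
  by rewrite addrC subrK.
apply: ccvgD; first exact: ccvg_cst.
by apply: ccvgM => //; apply: ccvg_real; exact: cvg_harmonic.
Qed.

(** The terms [k = 0] and [k = M] converge to the two main terms. The bound [pole_tail_le] on the
    others passes to the limit, where the pole of index 1 becomes [l + 3 pi i]. *)
Lemma pole_sum_remainder (l : R) (v : R) (e : nat) :
  ccvg (fun M => pole_sum l e.+1 M.+1) v%:C%C ->
  normc (v%:C%C - ((l +i* pi)%C ^+ e.+2)^-1 - ((l -i* pi)%C ^+ e.+2)^-1)
    <= 2 / normc (l +i* (3%:R * pi))%C ^+ e.
Proof.
move=> vlim; have pi0 := pi_gt0 R.
pose main k M := root_w l M.+1 k / pole l M.+1 k ^+ e.+2.
have z0 : (l +i* pi)%C != 0 by rewrite eq_complex/= negb_and orbC gt_eqF.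
have z0' : (l -i* pi)%C != 0.
  by rewrite eq_complex/= negb_and orbC oppr_eq0 gt_eqF.
have lim0 := ccvg_main_term e.+2 z0 _.
have {lim0}lim0 : ccvg (main 0) ((l +i* pi)%C ^+ e.+2)^-1.
  by apply: (lim0 l (fun=> 0)); have := ccvg_pole_fixed l 0; rewrite mul1r.
have limM : ccvg (fun M => main M M) ((l -i* pi)%C ^+ e.+2)^-1.
  exact: ccvg_main_term z0' (ccvg_pole_last l).
have lhs := cvg_normc (ccvgD (ccvgD vlim (ccvgN lim0)) (ccvgN limM)).
have q0 : 0 < normc (l +i* (3%:R * pi))%C.
  rewrite lt0r normc_ge0 andbT; apply: contraTneq isT.
  move=> /ComplexField.Normc.eq0_normc/eqP; rewrite eq_complex/= => /andP[_].
  by rewrite mulf_eq0 pnatr_eq0/= gt_eqF.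
have rhs : (fun M => 2 / normc (pole l M.+1 1) ^+ e) @ \oo -->
    2 / normc (l +i* (3%:R * pi))%C ^+ e.
  apply: cvgMr; apply: cvgV; first by rewrite expf_neq0 ?gt_eqF.
  rewrite -normcX; under eq_fun do rewrite -normcX.
  exact/cvg_normc/ccvgX/ccvg_pole_fixed.
(* [M > 0] keeps the two extracted indices distinct. *)
apply: (ler_cvg_to lhs rhs); exists 1%N => // M /= M0.
have := pole_tail_le l M e; congr (normc _ <= _).
rewrite /pole_sum -(big_mkord xpredT (fun k => main k M)).
by rewrite big_nat_recr//= (big_ltn (F := main^~ M) M0) /main; ring.
Qed.

End MainTerms.

(** The remainder is multiplied by [rho ^+ e.+2]. As [rho ^+ 2 = z * z'], the main terms
    [(rho / z) ^+ e.+2] and [(rho / z') ^+ e.+2] become [(z' / rho) ^+ e.+2] and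
    [(z / rho) ^+ e.+2], whose sum is [Jhat]; two factors [rho] go into the prefactor. *)
Lemma scaled_eulerian_Jhat_le (R : realType) (A : nat -> {poly R}) (x : R)
    (e : nat) :
  is_eulerian A -> x < 0 ->
  let l := ln `|x| in
  ComplexField.Normc.normc ((scaled_eulerian A e.+1 x)%:C%C - Jhat e.+1 x) <=
    2 * (l ^+ 2 + pi ^+ 2) *
    (Num.sqrt (l ^+ 2 + pi ^+ 2) / Num.sqrt (l ^+ 2 + (3%:R * pi) ^+ 2)) ^+ e.
Proof.
move=> eulA x0 /=; set l := ln _; have pi0 := pi_gt0 R.
have xE : x = - expR l.
  by rewrite /l lnK ?posrE ?normr_gt0 ?lt_eqF// ltr0_norm// opprK.
pose v n := x * (A n).[x] / (n`!%:R * (x - 1) ^+ n.+1).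
have vrec n : \sum_(j < n.+1) v j / (n - j)`!%:R - (- expR l) * v n =
    - (if n == 0 then - expR l else 0).
  by rewrite -xE; exact: eulerian_recurrence.
have := pole_sum_remainder (ccvg_pole_sum vrec e.+1).
set z := (l +i* pi)%C; set z' := (l -i* pi)%C.
set rho2 := l ^+ 2 + pi ^+ 2; pose rho := Num.sqrt rho2.
have rho2_gt0 : 0 < rho2 by rewrite ltr_wpDl ?sqr_ge0// exprn_gt0.
have rho0 : 0 < rho by rewrite sqrtr_gt0.
have rhoX n : rho2 `^ (n%:R / 2) = rho ^+ n.
  by rewrite mulrC powRrM powR12_sqrt ?ltW// powR_mulrn ?sqrtr_ge0.
have rhoE : (rho ^+ 2)%:C%C = z * z'.
  rewrite sqr_sqrtr ?ltW//; apply/eqP; rewrite eq_complex/=.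
  by apply/andP; split; apply/eqP; rewrite /rho2; ring.
have rhoC0 : rho%:C%C != 0 :> R[i] by rewrite eq_complex/= gt_eqF.
have z0 : z != 0 by rewrite eq_complex/= negb_and orbC gt_eqF.
have z0' : z' != 0 by rewrite eq_complex/= negb_and orbC oppr_eq0 gt_eqF.
move=> bound.
have -> : (scaled_eulerian A e.+1 x)%:C%C - Jhat e.+1 x =
    (rho ^+ e.+2)%:C%C * ((v e.+1)%:C%C - (z ^+ e.+2)^-1 - (z' ^+ e.+2)^-1).
  rewrite /scaled_eulerian /Jhat -/l -/rho2 !rhoX -/z -/z'.
  have -> : x * (A e.+1).[x] * rho ^+ e.+2 / (e.+1`!%:R * (x - 1) ^+ e.+2) =
      rho ^+ e.+2 * v e.+1 by rewrite /v; ring.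
  rewrite rmorphM/= -addrA mulrDr -opprD mulrN; congr (_ - _).
  have rhoXX : (rho%:C%C ^+ e.+2) * (rho%:C%C ^+ e.+2) = z ^+ e.+2 * z' ^+ e.+2.
    by rewrite -!exprMn -rhoE expr2 rmorphM.
  rewrite rmorphXn/=; apply: (mulIf (expf_neq0 e.+2 rhoC0)).
  rewrite divfK ?expf_neq0// mulrAC rhoXX.
  by field; rewrite !expf_neq0.
have rhoe : 0 <= rho ^+ e.+2 by rewrite exprn_ge0 ?ltW.
rewrite ComplexField.Normc.normcM normc_real ger0_norm//.
apply: (le_trans (ler_wpM2l rhoe bound)).
rewrite -/rho /= expr_div_n -[e.+2]addn2 exprD (sqr_sqrtr (ltW rho2_gt0)).
by rewrite le_eqVlt; apply/orP; left; apply/eqP; ring.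
Qed.

(** * Decay of the remainder on the window *)

Lemma Lseq_sqr (R : realType) (c : R) (n : nat) : (1 < n)%N ->
  Lseq c n ^+ 2 = c ^+ 2 * (n%:R / ln n%:R).
Proof.
move=> n1; rewrite exprMn sqr_sqrtr// divr_ge0// ln_ge0// ler1n ltnW//.
Qed.

(** The first bound comes from [ln n >= 1 - 1 / n]. For the second, [ln r < r] at [r = sqrt n]
    leaves [36 r <= 3 r ^ 2 - 4], true from [r = 13] on, whence [169 = 13 ^ 2]. *)
Lemma ln_nat_bounds (R : realType) (n : nat) : (169 <= n)%N ->
  1 / 2 <= ln n%:R :> R /\ 18 * ln n%:R <= 3 * n%:R - 4 :> R.
Proof.
move=> n169; have nR : 169 <= n%:R :> R by rewrite (ler_nat R 169).
have n0 : 0 < n%:R :> R by lra.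
split.
  have := @le_ln1Dx R (n%:R^-1 - 1).
  rewrite addrCA subrr addr0 lnV ?posrE//.
  have nV : n%:R^-1 <= 1 / 2 :> R by rewrite ler_pdivlMr// mulrC ler_pdivrMr//;
    lra.
  have := @invr_gt0 R n%:R; rewrite n0 => nV0 H.
  have := H _; lra.
pose r := Num.sqrt n%:R : R.
have r0 : 0 <= r by exact: sqrtr_ge0.
have rr : r ^+ 2 = n%:R by rewrite sqr_sqrtr// ltW.
have r13 : 13 <= r by nra.
have rpos : 0 < r by lra.
have -> : ln n%:R = 2 * ln r by rewrite -rr lnXn// mulr_natl.
have := ln_sublinear rpos; rewrite -rr; nra.
Qed.

Lemma window_bound (R : realType) (c l : R) (e : nat) :
  0 < c -> c < pi / Num.sqrt 2 -> (169 <= e.+1)%N ->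
  `|l| <= Lseq c e.+1 ->
  2 * (l ^+ 2 + pi ^+ 2) *
    (Num.sqrt (l ^+ 2 + pi ^+ 2) / Num.sqrt (l ^+ 2 + (3%:R * pi) ^+ 2)) ^+ e
  <= 4 * pi ^+ 2 / e.+1%:R.
Proof.
move=> c0 cpi n169 lL; have pi0 := pi_gt0 R.
have c2 : c ^+ 2 <= pi ^+ 2 / 2.
  have s0 : 0 < Num.sqrt 2 :> R by rewrite sqrtr_gt0.
  have : (c * Num.sqrt 2) ^+ 2 <= pi ^+ 2.
    apply: lerXn2r; rewrite ?nnegrE ?mulr_ge0// ?ltW//.
    by rewrite -ltr_pdivlMr.
  by rewrite exprMn sqr_sqrtr// ler_pdivlMr.
have [ln2 ln18] := ln_nat_bounds R n169.
set n : R := e.+1%:R in ln2 ln18 *.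
have n169' : 169 <= n by rewrite (ler_nat R 169).
have ln0 : 0 < ln n by lra.
have n0 : 0 < n by lra.
have l2 : l ^+ 2 <= c ^+ 2 * (n / ln n).
  rewrite -Lseq_sqr; last exact: leq_trans n169.
  by rewrite -(real_normK (num_real l)) lerXn2r ?nnegrE// (le_trans _ lL).
set K := c ^+ 2 * (n / ln n) in l2.
have KE : K * ln n = c ^+ 2 * n by rewrite /K; field; rewrite gt_eqF.
have K0 : 0 <= K := le_trans (sqr_ge0 l) l2.
have pi20 : 0 < pi ^+ 2 :> R by rewrite exprn_gt0.
set a := l ^+ 2 + pi ^+ 2; set b := l ^+ 2 + (3%:R * pi) ^+ 2.
have bE : b = a + 8 * pi ^+ 2 by rewrite /a /b; ring.
have a0 : 0 < a by rewrite ltr_wpDl ?sqr_ge0.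
have b0 : 0 < b by lra.
(* The squared ratio is [1 - 8 pi ^ 2 / b], at most [expR (- 8 pi ^ 2 / b)]. *)
have ratio_le : Num.sqrt a / Num.sqrt b <= expR (- (4 * pi ^+ 2 / b)).
  rewrite -ler_sqr ?nnegrE ?expR_ge0 ?divr_ge0 ?sqrtr_ge0//.
  rewrite expr_div_n (sqr_sqrtr (ltW a0)) (sqr_sqrtr (ltW b0)) -expRM_natl.
  apply: le_trans (expR_ge1Dx _); rewrite ler_pdivrMr//.
by rewrite mulrDl mul1r -(mulrA 2) mulNr divfK ?gt_eqF//; lra.
have bK : b <= K + 9 * pi ^+ 2 by rewrite /b exprMn; lra.
(* With [b <= K + 9 pi ^ 2], the parts are [2 K ln n = 2 c ^ 2 n <= pi ^ 2 n] and
   [18 pi ^ 2 ln n <= pi ^ 2 (3 n - 4)]; the bounds add up to exactly [4 pi ^ 2 (n - 1)]. *)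
have expo : 2 * ln n <= 4 * pi ^+ 2 / b *+ e.
  have eE : n = e%:R + 1 by rewrite natr1.
  rewrite -(mulr_natr (_ / b)) mulrAC ler_pdivlMr//.
  apply: (@le_trans _ _ (2 * ln n * (K + 9 * pi ^+ 2))).
    by rewrite ler_wpM2l// mulr_ge0// ltW.
  rewrite (_ : e%:R = n - 1); last by rewrite eE addrK.
  nra.
have pow_le : (Num.sqrt a / Num.sqrt b) ^+ e <= (n ^+ 2)^-1.
  apply: le_trans (lerXn2r e _ _ ratio_le) _;
    rewrite ?nnegrE ?expR_ge0 ?divr_ge0 ?sqrtr_ge0//.
  rewrite -expRM_natl -[leRHS]lnK ?posrE ?invr_gt0 ?exprn_gt0// ler_expR.
  by rewrite lnV ?posrE ?exprn_gt0// lnXn// mulrN lerN2 [leRHS]mulr_natl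
    (le_trans _ expo)// mulr_natl.
(* [ln n >= 1 / 2] gives [K <= 2 c ^ 2 n <= pi ^ 2 n]. *)
have a_le : a <= 2 * pi ^+ 2 * n.
  have : K <= 2 * c ^+ 2 * n by nra.
  rewrite /a; nra.
have -> : 4 * pi ^+ 2 / n = 2 * (2 * pi ^+ 2 * n) * (n ^+ 2)^-1.
  by field; rewrite gt_eqF.
apply: ler_pM => //; first by rewrite mulr_ge0// ltW.
by rewrite ler_pM2l.
Qed.

Theorem theorem7 (R : realType) (A : nat -> {poly R}) (c : R) :
  is_eulerian A ->
  0 < c -> c < pi / Num.sqrt 2 ->
  (fun n : nat =>
     ereal_sup [set (ComplexField.Normc.normc
                       ((scaled_eulerian A n x)%:C%C - Jhat n x))%:E
               | x in [set x : R | (xseq c n)^-1 <= x <= xseq c n]])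
    @ \oo --> (0 : \bar R)%E.
Proof.
move=> eulA c0 cpi.
(* The pointwise bound [4 pi ^ 2 / n] is enlarged to [8 pi ^ 2 / n.+1], a multiple of the harmonic
   sequence. *)
apply: (@squeeze_cvge _ _ _ _ (fun=> 0%E) _
  (fun n => (8 * pi ^+ 2 * n.+1%:R^-1)%:E)); last 2 first.
- exact: cvg_cst.
- apply: cvg_EFin; first exact: nearW.
  by rewrite -[X in _ --> X](mulr0 (8 * pi ^+ 2)); apply: cvgMr;
    exact: cvg_harmonic.
exists 169%N => // n /= n169.
have L0 : 0 <= Lseq c n by rewrite mulr_ge0 ?sqrtr_ge0 ?ltW.
apply/andP; split.
  (* A supremum over the empty set would be [-oo]; [xseq c n] lies in the window because
     [Lseq c n >= 0]. *)
  apply: le_trans (ereal_sup_ubound _); last first.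
    exists (xseq c n) => //=; rewrite lexx andbT /xseq invrN lerN2 -expRN opprK
      ler_expR.
    by lra.
  by rewrite lee_fin normc_ge0.
apply: ge_ereal_sup => _ [x /andP[xl xr] <-]; rewrite lee_fin.
have x0 : x < 0 by apply: le_lt_trans xr _; rewrite oppr_lt0 expR_gt0.
(* In the variable [ln |x|] the window is the symmetric interval of radius [Lseq c n]. *)
have lnL : `|ln `|x| | <= Lseq c n.
  rewrite (ltr0_norm x0) ler_norml -[- Lseq c n]expRK -{2}[Lseq c n]expRK.
  rewrite !ler_ln ?posrE ?expR_gt0 ?oppr_gt0//; apply/andP; split.
    by move: xr; rewrite /xseq; lra.
  by move: xl; rewrite /xseq invrN -expRN opprK; lra.
case: n n169 L0 xl xr lnL => [//|e] n169 L0 xl xr lnL.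
apply: le_trans (scaled_eulerian_Jhat_le e eulA x0) _.
apply: le_trans (window_bound c0 cpi n169 lnL) _.
have -> : 4 * pi ^+ 2 / e.+1%:R = 8 * pi ^+ 2 * (2 * e.+1%:R)^-1 :> R.
  by field; rewrite ?natr1 ?nat1r pnatr_eq0.
rewrite ler_wpM2l//; first by rewrite mulr_ge0 ?sqr_ge0.
rewrite lef_pV2 ?posrE ?mulr_gt0//.
by rewrite -natrM ler_nat; lia.
Qed.
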